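(* Let $q$ be a prime power, $F$ a field of characteristic $p>0$ not dividing $q$, and $m=m(p,q)$. Assume that $(k,i)$ is a middle index for $n$ and let $j:=2k-n+m-i$. Then (i) $H^n_{k,i}\cong H^n_{n-k,m-i}$, and (ii) $H^n_{k,i}\cong H^n_{k,j}$ as $FG_n$-modules, where $G_n=\mathrm{GL}(n,q)$.
   Context: For $i\ge 1$ put $[i]_q=1+q+\dots+q^{i-1}$, and let $m=m(p,q):=\min\{i>1 : [i]_q=0 \text{ in } F\}$. For integers $n\ge 0$ and $k$ let $L^n_k$ be the set of $k$-dimensional subspaces of $\mathbb{F}_q^n$ and let $M^n_k=FL^n_k$ be the $F$-vector space with basis $L^n_k$ ($M^n_k=0$ if $k<0$ or $k>n$). The incidence map $\partial:M^n_k\to M^n_{k-1}$ is the linear map sending $x\in L^n_k$ to the sum of all $(k-1)$-dimensional subspaces of $x$. One has $\partial^m=0$. The group $G_n=\mathrm{GL}(n,q)$ acts on $M^n_k$ by permuting subspaces, commuting with $\partial$. For $0<i<m$ the incidence homology is the $FG_n$-module $$H^n_{k,i}:=(\ker\partial^i\cap M^n_k)\,/\,\partial^{m-i}(M^n_{k+m-i}).$$ A pair of integers $(k,i)$ is a middle index for $n$ if $0\le k\le n$, $0<i<m$ and $n<2k+m-i<n+m$. *)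

(* Defs.v *)
From HB Require Import structures.
From mathcomp Require Import all_boot all_order all_algebra.
From mathcomp Require Import all_fingroup all_solvable all_field all_character.

Set Implicit Arguments.
Unset Strict Implicit.
Unset Printing Implicit Defensive.

Import GRing.Theory.
Import VectorInternalTheory.
Local Open Scope ring_scope.

Definition qint (q i : nat) : nat := (\sum_(t < i) q ^ t)%N.

Definition is_qchar (F : nzRingType) (q m : nat) : Prop :=
  [/\ (1 < m)%N, (qint q m)%:R = 0 :> F
    & forall i, (1 < i)%N -> (qint q i)%:R = 0 :> F -> (m <= i)%N].

Lemma qchar_exists (F : fieldType) (p q : nat) :
  p \in [pchar F] -> ~~ (p %| q)%N -> exists m, is_qchar F q m.
Proof.
move=> pF pNq; have p_pr := pcharf_prime pF.
suff ex : exists i, (1 < i)%N && ((qint q i)%:R == 0 :> F).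
  case: (ex_minnP ex) => m /andP[m_gt1 /eqP qm0] min_m.
  by exists m; split=> // i i_gt1 qi0; rewrite min_m // i_gt1 qi0 eqxx.
have qintE i : q%:R != 1 :> F -> (qint q i)%:R * (q%:R - 1) = q%:R ^+ i - 1 :> F.
  move=> _; elim: i => [|i IH]; first by rewrite /qint big_ord0 mul0r expr0 subrr.
  rewrite /qint big_ord_recr /= natrD mulrDl IH natrX exprS mulrBr mulr1.
  by rewrite [_ * q%:R]mulrC addrC subrKA.
have [q1|q_neq1] := eqVneq (q%:R : F) 1.
  exists p; rewrite prime_gt1 //= /qint natr_sum.
  rewrite (eq_bigr (fun=> 1)) => [|t _]; last by rewrite natrX q1 expr1n.
  by rewrite sumr_const card_ord pcharf0.
exists p.-1; have q_fermat : q%:R ^+ p.-1 = 1 :> F.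
  have qN0 : q%:R != 0 :> F by rewrite -(dvdn_pcharf pF).
  apply: (mulfI qN0); rewrite -exprS prednK ?prime_gt0 // mulr1.
  by rewrite -[LHS](pFrobenius_autE pF) pFrobenius_aut_nat.
apply/andP; split; last first.
  have := qintE p.-1 q_neq1; rewrite q_fermat subrr => /eqP.
  by rewrite mulf_eq0 subr_eq0 (negbTE q_neq1) orbF.
rewrite ltnNge; apply: contra q_neq1 => p_le1; move: q_fermat.
have -> : p.-1 = 1%N by have := prime_gt1 p_pr; case: (p) p_le1 => [|[|[]]].
by rewrite expr1 => ->.
Qed.

(* Naturals suffice: the constraints force k, i >= 0, and i < m makes
   [m - i] an exact difference. *)
Definition middle_index (m n k i : nat) : bool :=
  [&& (k <= n)%N, (0 < i < m)%N & (n < 2 * k + (m - i) < n + m)%N].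

(* The library type {'GL_n[R]} consists of matrices of size n.-1.+1, so it is
   not GL(n, q) for n = 0; the following is, for every n. *)
Record GL (K : finFieldType) (n : nat) :=
  MkGL { GLmx :> 'M[K]_n; GL_unit : GLmx \in unitmx }.

HB.instance Definition _ (K : finFieldType) (n : nat) :=
  [isSub for @GLmx K n].
HB.instance Definition _ (K : finFieldType) (n : nat) :=
  [Finite of GL K n by <:].

Section GLgroup.
Variables (K : finFieldType) (n : nat).
Implicit Types g h : GL K n.

Fact GL_mul_subproof g h : g *m h \in unitmx.
Proof. by rewrite unitmx_mul !GL_unit. Qed.
Fact GL_inv_subproof g : invmx g \in unitmx.
Proof. by rewrite unitmx_inv GL_unit. Qed.

Definition GL_one : GL K n := MkGL (unitmx1 K n).
Definition GL_mul g h : GL K n := MkGL (GL_mul_subproof g h).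
Definition GL_inv g : GL K n := MkGL (GL_inv_subproof g).

Fact GL_mulA : associative GL_mul.
Proof. by move=> x y z; apply: val_inj; rewrite /= mulmxA. Qed.
Fact GL_mul1 : left_id GL_one GL_mul.
Proof. by move=> x; apply: val_inj; rewrite /= mul1mx. Qed.
Fact GL_mulV : left_inverse GL_one GL_inv GL_mul.
Proof. by move=> x; apply: val_inj; rewrite /= mulVmx ?GL_unit. Qed.

HB.instance Definition _ :=
  Finite_isGroup.Build (GL K n) GL_mulA GL_mul1 GL_mulV.

End GLgroup.

HB.instance Definition _ (K : finFieldType) (vT : vectType K) :=
  [Finite of {vspace vT} by <:].

Section IncidenceHomology.
Variables (F : fieldType) (K : finFieldType) (n : nat).

Local Notation subspace := {vspace 'rV[K]_n}.
(* The sum over all k of the M^n_k is the space of row vectors 'rV[F]_N, whose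
   standard basis is indexed by all subspaces through [enum_val]; FG-modules
   are right modules, and linear maps act by right multiplication. *)
Local Notation N := #|{: {vspace 'rV[K]_n}}|.

Definition GLact (g : GL K n) (U : subspace) : subspace :=
  (linfun (mulmxr g : 'rV[K]_n -> 'rV[K]_n) @: U)%VS.

Definition grass_mx (g : GL K n) : 'M[F]_N :=
  \matrix_(a < N, b < N) (enum_val b == GLact g (enum_val a))%:R.

Fact linfun_mulmxrE (g : GL K n) (v : 'rV[K]_n) :
  linfun (mulmxr g : 'rV[K]_n -> 'rV[K]_n) v = v *m g.
Proof. by rewrite lfunE. Qed.

Lemma GLact1 (U : subspace) : GLact 1%g U = U.
Proof.
rewrite /GLact -[RHS]lim1g; congr (_ @: _)%VS; apply/lfunP=> v.
by rewrite linfun_mulmxrE mulmx1 id_lfunE.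
Qed.

Lemma GLactM g h (U : subspace) : GLact (g * h)%g U = GLact h (GLact g U).
Proof.
rewrite /GLact -limg_comp; congr (_ @: _)%VS; apply/lfunP=> v.
by rewrite comp_lfunE !linfun_mulmxrE mulmxA.
Qed.

Lemma GLact_inj g : injective (GLact g).
Proof.
by apply: (can_inj (g := GLact g^-1%g)) => U; rewrite -GLactM mulgV GLact1.
Qed.

Lemma GLactS g (U V : subspace) : (GLact g U <= GLact g V)%VS = (U <= V)%VS.
Proof.
apply/idP/idP; last exact: limgS.
move=> /(limgS (linfun (mulmxr (g^-1)%g : 'rV[K]_n -> 'rV[K]_n))).
by rewrite -/(GLact _ _) -/(GLact _ (GLact g V)) -!GLactM mulgV !GLact1.
Qed.

Lemma dim_GLact g (U : subspace) : \dim (GLact g U) = \dim U.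
Proof.
apply/eqP; rewrite eqn_leq.
have le h W : (\dim (GLact h W) <= \dim W)%N by rewrite /GLact -[leqRHS](limg_ker_dim (linfun (mulmxr h : 'rV[K]_n -> 'rV[K]_n))) leq_addl.
by rewrite le -[X in (\dim X <= _)%N](GLact1 U) -(mulgV g) GLactM le.
Qed.

Fact grass_mx_repr : mx_repr [set: GL K n] grass_mx.
Proof.
split=> [|g h _ _].
  apply/matrixP=> a b; rewrite !mxE GLact1 (inj_eq enum_val_inj).
  by rewrite eq_sym.
apply/matrixP=> a b; rewrite !mxE.
rewrite (bigD1 (enum_rank (GLact g (enum_val a)))) //= big1 ?addr0.
  by rewrite !mxE !enum_rankK eqxx mul1r GLactM.
move=> c neq_c; rewrite !mxE.
have /negbTE-> : enum_val c != GLact g (enum_val a).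
  by apply: contra neq_c => /eqP<-; rewrite enum_valK.
by rewrite mul0r.
Qed.

Canonical grass_repr := MxRepresentation grass_mx_repr.

(* The row space of [chain_mx k] is M^n_k; it is 0 for k > n. *)
Definition chain_mx (k : nat) : 'M[F]_N :=
  diag_mx (\row_(a < N) (\dim (enum_val a) == k)%:R).

Definition incidence_mx : 'M[F]_N :=
  \matrix_(a < N, b < N)
    ((enum_val b <= enum_val a)%VS
       && (\dim (enum_val a) == (\dim (enum_val b)).+1))%:R.

Definition cycle_mx (k i : nat) : 'M[F]_N :=
  (kermx (incidence_mx ^+ i) :&: chain_mx k)%MS.

Definition boundary_mx (m k i : nat) : 'M[F]_N :=
  chain_mx (k + (m - i)) *m incidence_mx ^+ (m - i).

Lemma mul_grassE g (A : 'M[F]_N) a b :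
  (grass_mx g *m A) a b = A (enum_rank (GLact g (enum_val a))) b.
Proof.
rewrite !mxE (bigD1 (enum_rank (GLact g (enum_val a)))) //= big1 ?addr0.
  by rewrite mxE enum_rankK eqxx mul1r.
move=> c neq_c; rewrite !mxE.
have /negbTE-> : enum_val c != GLact g (enum_val a).
  by apply: contra neq_c => /eqP<-; rewrite enum_valK.
by rewrite mul0r.
Qed.

Lemma mul_mx_grassE g (A : 'M[F]_N) a b :
  (A *m grass_mx g) a b = A a (enum_rank (GLact g^-1%g (enum_val b))).
Proof.
rewrite !mxE (bigD1 (enum_rank (GLact g^-1%g (enum_val b)))) //= big1 ?addr0.
  by rewrite mxE enum_rankK -GLactM mulVg GLact1 eqxx mulr1.
move=> c neq_c; rewrite !mxE.
have /negbTE-> : enum_val b != GLact g (enum_val c).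
  apply: contra neq_c => /eqP->.
  by rewrite -GLactM mulgV GLact1 enum_valK.
by rewrite mulr0.
Qed.

Lemma incidence_mx_comm g :
  incidence_mx *m grass_mx g = grass_mx g *m incidence_mx.
Proof.
apply/matrixP=> a b; rewrite mul_grassE mul_mx_grassE !mxE !enum_rankK.
rewrite !dim_GLact; congr (_ && _)%:R.
by rewrite -(GLactS g) -GLactM mulVg GLact1.
Qed.

Lemma incidence_mxX_comm g i :
  incidence_mx ^+ i *m grass_mx g = grass_mx g *m incidence_mx ^+ i.
Proof.
by apply/esym/(@commrX _ (grass_mx g) incidence_mx i)/esym/incidence_mx_comm.
Qed.

Lemma chain_mx_comm g k :
  chain_mx k *m grass_mx g = grass_mx g *m chain_mx k.
Proof.
apply/matrixP=> a b; rewrite mul_grassE mul_mx_grassE !mxE.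
rewrite enum_rankK dim_GLact; congr (_ *+ nat_of_bool _).
by apply/eqP/eqP => [->|<-]; rewrite enum_rankK -GLactM ?mulVg ?mulgV GLact1
  enum_valK.
Qed.

Lemma cycle_module k i : mxmodule grass_repr (cycle_mx k i).
Proof.
apply: capmx_module; apply/mxmoduleP=> g _.
  apply/sub_kermxP; rewrite -mulmxA -[grass_repr g]/(grass_mx g).
  by rewrite -incidence_mxX_comm mulmxA mulmx_ker mul0mx.
by rewrite -[grass_repr g]/(grass_mx g) chain_mx_comm submxMl.
Qed.

Lemma boundary_module m k i : mxmodule grass_repr (boundary_mx m k i).
Proof.
apply/mxmoduleP=> g _; rewrite -[grass_repr g]/(grass_mx g) /boundary_mx.
by rewrite -mulmxA incidence_mxX_comm mulmxA chain_mx_comm -mulmxA submxMl.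
Qed.

(* [section_repr] represents (Z + B) / B, which is Z / B because the m-th power
   of the incidence map vanishes when [is_qchar F #|K| m]. *)
Definition incidence_homology (m k i : nat) :=
  section_repr (boundary_module m k i) (cycle_module k i).

End IncidenceHomology.

(* Main.v *)
Require Import Defs.
From HB Require Import structures.
From mathcomp Require Import all_boot all_order all_algebra.
From mathcomp Require Import all_fingroup all_solvable all_field all_character.
From mathcomp Require Import ring zify.

(* Let U be the transpose of the incidence map D.  On M_k the commutator of the
   two is the scalar [n - k] - [k], so M is a graded module over a form of
   quantum sl2 at a root of unity.  Its simple graded subquotients are strings
   v, vU, ..., vU^r, and on each of them one reads off, using D^m = 0, that
   ker D^e = im D^(m - e) in degree k whenever 0 < e < m and 2k = n + e mod m.
   Middle exactness carries this vanishing over to M.  It makes the two natural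
   maps isomorphisms: the inclusion of ker D^i in ker D^j for i <= j gives (ii),
   and D^(2k - n) : H_{k,i} -> H_{n-k,i-(2k-n)}, for n <= 2k, followed by (ii)
   gives (i). *)

Set Implicit Arguments.
Unset Strict Implicit.
Unset Printing Implicit Defensive.

Import GRing.Theory.
Local Open Scope ring_scope.

(** * Similarity of section modules *)

(** The map that [f] induces from (U1 + V1)/U1 to (U2 + V2)/U2 is well defined, onto and injective
    by the four inclusion hypotheses, so its matrix in the bases of the two sections is an
    invertible intertwiner. Injectivity need only be tested on [V1], because [f] carries [U1] into
    [U2]. *)
Lemma section_rsim_hom (F : fieldType) (gT : finGroupType) (G : {group gT})
    (n : nat) (rG : mx_representation F G n) (U1 V1 U2 V2 f : 'M[F]_n)
    (modU1 : mxmodule rG U1) (modV1 : mxmodule rG V1)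
    (modU2 : mxmodule rG U2) (modV2 : mxmodule rG V2) :
    {in G, forall x, f *m rG x = rG x *m f} ->
    (U1 *m f <= U2)%MS -> (V1 *m f <= U2 + V2)%MS ->
    (V2 <= U2 + V1 *m f)%MS ->
    (forall u : 'rV_n, (u <= V1)%MS -> (u *m f <= U2)%MS -> (u <= U1)%MS) ->
  mx_rsim (section_repr modU1 modV1) (section_repr modU2 modV2).
Proof.
move=> fG U1f V1f V2f injf; set n1 := \rank <<in_factmod U1 V1>>%MS.
(* The rows of [v1] are representatives in U1 + V1 of the basis of the first section; [B] below
   writes their images in the basis of the second. *)
pose v1 := val_factmod (val_submod (1%:M : 'M_n1)).
have sv1: (v1 <= U1 + V1)%MS.
  by rewrite (submx_trans _ (proj_factmodS _ _)) // submxMr // val_submod1 genmxE.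
have sV1: (V1 <= U1 + v1)%MS.
  apply: submx_trans (addsmxSr U1 V1) _.
  rewrite -(in_factmodsK (addsmxSl U1 V1)) addsmxS // val_factmodS val_submod1.
  by rewrite genmxE in_factmod_addsK.
have sv1f: (v1 *m f <= U2 + V2)%MS.
  apply: submx_trans (submxMr f sv1) _; rewrite addsmxMr addsmx_sub V1f.
  by rewrite (submx_trans U1f) ?addsmxSl.
have sfact: (in_factmod U2 (v1 *m f) <= <<in_factmod U2 V2>>)%MS.
  by rewrite genmxE -(in_factmod_addsK U2 V2) submxMr.
pose B := in_submod <<in_factmod U2 V2>>%MS (in_factmod U2 (v1 *m f)).
have mulB k (X : 'M_(k, n1)) :
    X *m B = in_submod <<in_factmod U2 V2>>%MS (in_factmod U2 (X *m (v1 *m f))).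
  by rewrite /B /in_submod /in_factmod /= !mulmxA.
have freeB : row_free B.
  rewrite -kermx_eq0; apply/rowV0P=> u; rewrite (sameP sub_kermxP eqP).
  rewrite mulB -(inj_eq val_submod_inj) linear0 in_submodK; last first.
    by apply: submx_trans sfact; rewrite /in_factmod /= submxMr ?submxMl.
  rewrite in_factmod_eq0 mulmxA => uv1f.
  apply: val_submod_inj; apply/eqP; rewrite linear0 -[val_submod _]val_factmodK.
  rewrite in_factmod_eq0 val_factmodE val_submodE -mulmxA -val_factmodE.
  (* Only the [V1] part of this vector matters: its image stays in [U2], so [injf] places it in
     [U1]. *)
  have /sub_addsmxP[[a b] /= Eu] : (u *m v1 <= U1 + V1)%MS by apply: mulmx_sub.
  rewrite -/v1 Eu addmx_sub ?submxMl // injf ?submxMl //.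
  have -> : b *m V1 *m f = u *m v1 *m f - a *m U1 *m f.
    by rewrite Eu mulmxDl addrC addKr.
  by rewrite addmx_sub // eqmx_opp -mulmxA mulmx_sub.
have fullB : row_full B.
  rewrite -sub1mx -val_submodS in_submodK // val_submod1 genmxE.
  have sV2 : (V2 <= U2 + v1 *m f)%MS.
    apply: submx_trans V2f _; rewrite addsmx_sub addsmxSl /=.
    apply: submx_trans (submxMr f sV1) _.
    by rewrite addsmxMr addsmx_sub addsmxSr (submx_trans U1f) ?addsmxSl.
  by rewrite -(in_factmod_addsK U2 (v1 *m f)) submxMr.
exists B => // [|x Gx]; first by rewrite -(eqP freeB) (eqP fullB).
(* Acting on the representatives agrees with the section action [X] up to [U1], and [f] sends this
   error into [U2]. *)
symmetry; rewrite /B -{1}in_submodJ // -{1}in_factmodJ //.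
rewrite -[in RHS]/B mulB -/v1; set X := section_repr _ _ _.
congr (in_submod _ _).
apply/eqP; rewrite -subr_eq0 -linearB in_factmod_eq0 /=.
rewrite -[v1 *m f *m _]mulmxA fG // mulmxA [X *m _]mulmxA -mulmxBl.
apply: submx_trans (submxMr f _) U1f.
rewrite -in_factmod_eq0 linearB /= subr_eq0 {1}(in_factmodJ modU1) //.
have -> : X *m v1 = val_factmod (X *m val_submod 1%:M).
  by rewrite /v1 /val_factmod mulmxA.
by rewrite !val_factmodK -val_submodE -[X]mul1mx /X val_submodJ.
Qed.

(** * Quantum integers *)

Lemma qintS q i : qint q i.+1 = (qint q i + q ^ i)%N.
Proof. by rewrite /qint big_ord_recr. Qed.

Lemma qintD q a b : qint q (a + b) = (qint q a + q ^ a * qint q b)%N.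
Proof.
elim: b => [|b IH]; first by rewrite /qint big_ord0 muln0 !addn0.
by rewrite addnS !qintS IH mulnDr -expnD addnA.
Qed.

Lemma qint1 q : qint q 1 = 1%N.
Proof. by rewrite /qint big_ord1. Qed.

Section QuantumCharacteristic.
Variables (F : fieldType) (q m : nat).
Hypotheses (q_neq0 : q%:R != 0 :> F) (hm : is_qchar F q m).
Local Notation "[ i ]" := ((qint q i)%:R : F).

(** Since [m + s] = [m] + q^m [s] with [m] = 0 and q invertible, vanishing depends only on the
    residue mod m. Below m, minimality and [1] = 1 leave only 0. *)
Lemma qint_eq0 t : ([t] == 0) = (m %| t)%N.
Proof.
have [m_gt1 m0 m_min] := hm.
have small s : (s < m)%N -> ([s] == 0) = (s == 0%N).
  case: s => [|[|s]] lt_sm; first by rewrite /qint big_ord0 !eqxx.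
    by rewrite qint1 oner_eq0.
  by apply/negP=> /eqP/(m_min s.+2 isT); rewrite leqNgt lt_sm.
elim/ltn_ind: t => t IH; have [lt_tm|le_mt] := ltnP t m.
  rewrite small //; case: t lt_tm {IH} => [|t] lt_tm; first by rewrite dvdn0.
  by rewrite gtnNdvd.
rewrite -{1}(subnKC le_mt) qintD natrD m0 add0r natrM natrX mulf_eq0.
rewrite expf_eq0 (negPf q_neq0) andbF /= IH ?dvdn_subl //.
by rewrite ltn_subrL; apply/andP; split; lia.
Qed.

(** For b <= a, [a] - [b] = q^b [a - b], with q invertible. *)
Lemma qint_inj_mod a b : [a] = [b] -> a = b %[mod m].
Proof.
wlog le_ba : a b / (b <= a)%N.
  by move=> IH Eab; case/orP: (leq_total a b) => le; first symmetry; apply: IH.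
rewrite -(subnKC le_ba) qintD natrD -[RHS]addr0 => /addrI/eqP.
rewrite natrM natrX mulf_eq0 expf_eq0 (negPf q_neq0) andbF /= qint_eq0.
by move=> /eqP dv; rewrite -modnDmr dv addn0.
Qed.

End QuantumCharacteristic.

(** * Exactness in graded modules with lowering and raising maps *)

Section GradedExactness.
Variables (F : fieldType) (N n q m : nat) (D U : 'M[F]_N) (P : nat -> 'M[F]_N).
Local Notation "[ i ]" := ((qint q i)%:R : F).
Hypotheses (q_neq0 : q%:R != 0 :> F) (hm : is_qchar F q m).
Hypothesis PP : forall k l, P k *m P l = (if k == l then P k else 0).
Hypothesis sumP : \sum_(k < n.+1) P k = 1%:M.
Hypothesis PD : forall k, P k.+1 *m D = D *m P k.
Hypothesis PD0 : P 0 *m D = 0.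
Hypothesis PU : forall k, P k *m U = U *m P k.+1.
Hypothesis PUD : forall k, (k <= n)%N ->
  P k *m (U *m D) = P k *m (D *m U) + ([n - k] - [k]) *: P k.
Hypothesis Dm0 : D ^+ m = 0.

Let mxS (X : 'M[F]_N) a : X ^+ a.+1 = X *m X ^+ a. Proof. exact: exprS. Qed.
Let mxSr (X : 'M[F]_N) a : X ^+ a.+1 = X ^+ a *m X. Proof. exact: exprSr. Qed.
Let mxD (X : 'M[F]_N) a b : X ^+ (a + b) = X ^+ a *m X ^+ b.
Proof. exact: exprD. Qed.
Let mx0 (X : 'M[F]_N) : X ^+ 0 = 1%:M. Proof. exact: expr0. Qed.

Lemma grade_gt k : (n < k)%N -> P k = 0.
Proof.
move=> lt_nk; rewrite -[P k]mulmx1 -sumP mulmx_sumr big1 // => i _.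
by rewrite PP; case: eqP => // Ek; have := ltn_ord i; lia.
Qed.

Lemma grade_powD k b : P (k + b) *m D ^+ b = D ^+ b *m P k.
Proof.
elim: b => [|b IH] in k *; first by rewrite mx0 addn0 mulmx1 mul1mx.
by rewrite mxS mulmxA addnS PD -mulmxA IH mulmxA.
Qed.

Lemma grade_powU k b : P k *m U ^+ b = U ^+ b *m P (k + b).
Proof.
elim: b => [|b IH] in k *; first by rewrite mx0 addn0 mulmx1 mul1mx.
by rewrite mxS mulmxA PU -mulmxA IH mulmxA addnS.
Qed.

Lemma powD_low k b : (k < b)%N -> P k *m D ^+ b = 0.
Proof.
move=> lt_kb; rewrite -(subnKC lt_kb) mxD mxSr !mulmxA -[P k]/(P (0 + k)).
by rewrite grade_powD -[_ *m P 0 *m D]mulmxA PD0 mulmx0 mul0mx.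
Qed.

(** These are the graded submodules; computing modulo such an [A] stands in for passing to the
    quotient by it. *)
Definition graded_stable (A : 'M[F]_N) :=
  [/\ (A *m D <= A)%MS, (A *m U <= A)%MS & forall k, (A *m P k <= A)%MS].

Lemma stable_powD (A : 'M[F]_N) (x : 'rV_N) b :
  graded_stable A -> (x <= A)%MS -> (x *m D ^+ b <= A)%MS.
Proof.
case=> AD _ _; elim: b => [|b IH] xA; first by rewrite mx0 mulmx1.
by rewrite mxSr mulmxA (submx_trans (submxMr _ (IH xA))).
Qed.

(** * Strings raised from a vector that D kills modulo A *)

Section TopString.
Variables (A : 'M[F]_N) (v : 'rV[F]_N) (d : nat).
Hypotheses (stA : graded_stable A) (vP : v *m P d = v).
Hypothesis vD : (v *m D <= A)%MS.

(* [string_coef a] is the sum over [b < a] of the commutators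
   [n - (d + b)] - [d + b], as long as [a <= n - d + 1]. *)
Definition string_coef a := [a] * ([(n - d).+1 - a] - [d]).

Lemma string_grade s : v *m U ^+ s *m P (d + s) = v *m U ^+ s.
Proof. by rewrite -mulmxA -grade_powU mulmxA vP. Qed.

Lemma string_grade_le s : v *m U ^+ s != 0 -> (d + s <= n)%N.
Proof.
by apply: contraNT; rewrite -ltnNge -string_grade => /grade_gt->; rewrite mulmx0.
Qed.

Lemma string_coefS a : (d + a <= n)%N ->
  string_coef a.+1 = string_coef a + ([n - (d + a)] - [d + a]).
Proof.
move=> le_n; rewrite /string_coef subSS subSn; last by lia.
rewrite subnDA; set t := (n - d - a)%N.
(* Both sides expand [t + a], split off from either end. *)
have Eta : [t] + q%:R ^+ t * [a] = [a] + q%:R ^+ a * [t].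
  by rewrite -!natrX -!natrM -!natrD -!qintD addnC.
rewrite [(d + a)%N]addnC -addn1 -[t.+1]addn1 !qintD !qint1 !natrD !muln1.
rewrite !natrM !natrX; apply/eqP; rewrite -subr_eq0 -(subrr ([t] + q%:R ^+ t * [a])).
by rewrite {1}Eta; apply/eqP; ring.
Qed.

(** Moving [D] leftwards past each [U] costs one commutator scalar; these add up to [string_coef],
    and the remaining term starts with [v *m D], which lies in [A]. *)
Lemma string_down a : (d + a <= n)%N ->
  (v *m U ^+ a.+1 *m D - string_coef a.+1 *: (v *m U ^+ a) <= A)%MS.
Proof.
case: stA => AD AU AP; elim: a => [|a IH] le_n.
  rewrite string_coefS // /string_coef {1}/qint big_ord0 mul0r add0r.
  rewrite addn0 in le_n *.
  have Ew : v *m (U *m D) = v *m D *m U + ([n - d] - [d]) *: v.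
    by rewrite -{1}vP -mulmxA PUD // mulmxDr -scalemxAr !mulmxA vP.
  rewrite mx0 mulmx1 mxS mx0 mulmx1 -mulmxA Ew addrK.
  exact: submx_trans (submxMr _ vD) AU.
have {}IH := IH (leq_trans (leq_add (leqnn d) (leqnSn a)) le_n).
set w := v *m U ^+ a.+1 in IH *.
have wP : w *m P (d + a.+1) = w by apply: string_grade.
have Ew : w *m (U *m D) =
    w *m D *m U + ([n - (d + a.+1)] - [d + a.+1]) *: w.
  by rewrite -{1}wP -mulmxA PUD // mulmxDr -scalemxAr !mulmxA wP.
have -> : v *m U ^+ a.+2 *m D = w *m (U *m D) by rewrite mxSr !mulmxA.
rewrite Ew (string_coefS le_n) scalerDl opprD addrACA subrr addr0.
rewrite {2}/w mxSr mulmxA scalemxAl -mulmxBl.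
exact: submx_trans (submxMr _ IH) AU.
Qed.

(** Iterate [string_down]: the scalar is the product of the coefficients met on the way down, all
    nonzero inside the string. *)
Lemma string_powD r s b : (d + r <= n)%N ->
    (forall a, (a < r)%N -> string_coef a.+1 != 0) ->
    (s <= r)%N -> (b <= s)%N ->
  exists2 g, g != 0 & (v *m U ^+ s *m D ^+ b - g *: (v *m U ^+ (s - b)) <= A)%MS.
Proof.
have [AD _ _] := stA; move=> le_n c_neq0 le_sr; elim: b => [|b IH] le_bs.
  by exists 1; rewrite ?oner_neq0 // mx0 mulmx1 subn0 scale1r subrr sub0mx.
have [g g_neq0 gA] := IH (ltnW le_bs).
have Es : (s - b = (s - b.+1).+1)%N by lia.
exists (g * string_coef (s - b)).
  by rewrite mulf_neq0 // Es c_neq0; lia.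
rewrite mxSr mulmxA.
have -> : v *m U ^+ s *m D ^+ b *m D -
     (g * string_coef (s - b)) *: (v *m U ^+ (s - b.+1)) =
   (v *m U ^+ s *m D ^+ b - g *: (v *m U ^+ (s - b))) *m D +
   g *: (v *m U ^+ (s - b) *m D - string_coef (s - b) *: (v *m U ^+ (s - b.+1))).
  by rewrite mulmxBl -scalemxAl scalerBr scalerA addrA subrK.
rewrite addmx_sub ?(submx_trans (submxMr _ gA)) // scalemx_sub // Es.
by apply: string_down; lia.
Qed.

Hypothesis vA : ~~ (v <= A)%MS.
Hypothesis top_d : forall d' (u : 'rV_N), (d < d')%N -> u *m P d' = u ->
  (u *m D <= A)%MS -> (u <= A)%MS.

(** Take the least r with vU^(r+1) in [A]. Applying [D] to this vector forces [string_coef] to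
    vanish at r + 1, and its two factors give the two alternatives for r. *)
Lemma string_length : exists r,
  [/\ (r < m)%N && (d + r <= n)%N, r.+1 = m \/ n = 2 * d + r %[mod m],
      (v *m U ^+ r.+1 <= A)%MS, forall a, (a <= r)%N -> ~~ (v *m U ^+ a <= A)%MS
    & forall a, (a < r)%N -> string_coef a.+1 != 0].
Proof.
have [m_gt1 qm0 _] := hm; have [AD _ _] := stA.
have ex : exists r, (v *m U ^+ r.+1 <= A)%MS.
  exists n; suff -> : v *m U ^+ n.+1 = 0 by apply: sub0mx.
  by apply/eqP/negP=> /negP/string_grade_le; lia.
case: (ex_minnP ex) => r vUr min_r; exists r.
have notA a : (a <= r)%N -> ~~ (v *m U ^+ a <= A)%MS.
  case: a => [|a] le_ar; first by rewrite mx0 mulmx1.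
  by apply/negP=> /min_r; lia.
have le_n : (d + r <= n)%N.
  apply: string_grade_le; apply: contra (notA r (leqnn r)) => /eqP->.
  exact: sub0mx.
(* A zero coefficient would make vU^(a+1) a vector killed by [D] modulo [A] in a degree above d,
   hence an element of [A] by maximality of d. *)
have coef_neq0 a : (a < r)%N -> string_coef a.+1 != 0.
  move=> lt_ar; apply: contra (notA a.+1 lt_ar) => /eqP c0.
  apply: (@top_d (d + a.+1)); first by lia.
    exact: string_grade.
  have := @string_down a; rewrite c0 scale0r subr0; apply; lia.
have coef_eq0 : string_coef r.+1 = 0.
  apply/eqP; apply: contraNT (notA r (leqnn r)) => c_neq0.
  rewrite -[v *m _](scalerK c_neq0) scalemx_sub //.
  have -> : string_coef r.+1 *: (v *m U ^+ r) = v *m U ^+ r.+1 *m D -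
      (v *m U ^+ r.+1 *m D - string_coef r.+1 *: (v *m U ^+ r)) by rewrite subKr.
  rewrite addmx_sub ?eqmx_opp ?string_down //.
  exact: submx_trans (submxMr _ vUr) AD.
(* A longer string would contain the coefficient at m, which is zero because [m] = 0. *)
have lt_rm : (r < m)%N.
  rewrite ltnNge; apply/negP=> le_mr.
  have := @coef_neq0 m.-1; rewrite prednK; last by lia.
  by rewrite /string_coef qm0 mul0r eqxx => /(_ ltac:(lia)).
split=> //; first by rewrite lt_rm.
move/eqP: coef_eq0; rewrite /string_coef mulf_eq0 subSS => /orP[|].
  by rewrite (qint_eq0 q_neq0 hm) => /dvdn_leq-/(_ isT); left; lia.
rewrite subr_eq0 => /eqP/(qint_inj_mod q_neq0 hm) Emod; right.
have -> : n = ((n - d - r) + (d + r))%N by lia.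
by rewrite -modnDml Emod modnDml; congr (modn _ _); lia.
Qed.

End TopString.

(** This guarantees room above position s to raise by [U] another m - e times. If r + 1 = m it is
    immediate; otherwise (r - s) + (e - s) is a positive multiple of m, hence at least m. *)
Lemma string_fit d r s e : (r < m)%N -> r.+1 = m \/ n = 2 * d + r %[mod m] ->
    2 * (d + s) = n + e %[mod m] -> (s <= r)%N -> (s < e < m)%N ->
  (s + (m - e) <= r)%N.
Proof.
move=> lt_rm [Er|Emod] Ee le_sr lt_se; first by lia.
have : 2 * d + 2 * s + 0 = 2 * d + 2 * s + ((r - s) + (e - s)) %[mod m].
  transitivity ((n + e) %% m)%N; first by rewrite -Ee; congr (modn _ _); lia.
  by rewrite -modnDml Emod modnDml {Emod Ee}; congr (modn _ _); lia.
move/eqP; rewrite eqn_modDl mod0n eq_sym -/(dvdn _ _) {Emod Ee}.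
set X := (_ + _)%N; move/dvdn_leq; rewrite /X; lia.
Qed.

(** The lowest degree not contained in [A] is carried into [A] by [D], so vectors killed modulo [A]
    exist outside [A]. As degrees are bounded by n, one of maximal degree can be chosen. *)
Lemma graded_top (A : 'M[F]_N) : graded_stable A -> ~~ (1%:M <= A)%MS ->
  exists d, exists v : 'rV_N,
    [/\ v *m P d = v, (v *m D <= A)%MS, ~~ (v <= A)%MS
      & forall d' (u : 'rV_N), (d < d')%N -> u *m P d' = u ->
          (u *m D <= A)%MS -> (u <= A)%MS].
Proof.
case=> AD AU AP A1.
(* Multiplying by [cokermx A] tests membership in [A], so [K d] is the kernel of [D] modulo [A] in
   degree d. *)
pose K d := (kermx (D *m cokermx A) :&: P d)%MS.
have inK d (u : 'rV_N) : (u <= K d)%MS <-> u *m P d = u /\ (u *m D <= A)%MS.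
  rewrite sub_capmx (sameP sub_kermxP eqP) mulmxA -submxE andbC.
  split=> [/andP[/submxP[w ->]] | [<- uD]]; last by rewrite submxMl.
  by move=> uD; rewrite -[in LHS]mulmxA PP eqxx.
have ex0 : exists d, ~~ (P d <= A)%MS.
  case: (pickP (fun k : 'I_n.+1 => ~~ (P k <= A)%MS)) => [k kA|all0]; first by exists k.
  case/negP: A1; rewrite -sumP; apply: summx_sub => k _.
  by apply/negPn; rewrite all0.
have exK : exists d, ~~ (K d <= A)%MS.
  case: (ex_minnP ex0) => d /row_subPn[i iA] min_d; exists d.
  apply: contra iA; apply: submx_trans; apply/inK.
  split; first by rewrite -row_mul PP eqxx.
  case: d min_d {ex0} => [|d] min_d; first by rewrite -row_mul PD0 row0 sub0mx.
  rewrite -row_mul PD row_mul mulmx_sub //.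
  by apply/negPn/negP=> /min_d; rewrite ltnn.
have leK d : ~~ (K d <= A)%MS -> (d <= n)%N.
  rewrite leqNgt; apply: contra => /grade_gt Pd0.
  by rewrite /K Pd0 capmx0 sub0mx.
case: (ex_maxnP exK leK) => d /row_subPn[i iA] max_d; exists d, (row i (K d)).
have [iP iD] := (inK d (row i (K d))).1 (row_sub i _).
split=> // d' u lt_d uP uD; apply/negPn/negP=> uA.
have /max_d : ~~ (K d' <= A)%MS.
  by apply: contra uA; apply: submx_trans; apply/inK.
by rewrite leqNgt lt_d.
Qed.

Definition string_mx (v : 'rV[F]_N) r := \matrix_(a < r.+1) (v *m U ^+ a).

Lemma string_mx_mem (A : 'M[F]_N) (v : 'rV_N) r a : (a <= r)%N ->
  (v *m U ^+ a <= A + string_mx v r)%MS.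
Proof.
rewrite -ltnS => lt_ar; apply: submx_trans (addsmxSr _ _).
by rewrite -[v *m _](rowK (fun b : 'I_r.+1 => v *m U ^+ b) (Ordinal lt_ar)) row_sub.
Qed.

(** [D] lowers along the string by [string_down], [U] raises along it and leaves its end into [A],
    and each string vector is homogeneous. *)
Lemma string_mx_stable (A : 'M[F]_N) (v : 'rV_N) d r :
    graded_stable A -> v *m P d = v -> (v *m D <= A)%MS -> (d + r <= n)%N ->
    (v *m U ^+ r.+1 <= A)%MS ->
  graded_stable (A + string_mx v r)%MS.
Proof.
move=> stA vP vD le_n vUr; have [AD AU AP] := stA; set W := string_mx v r.
have AW (z : 'rV_N) : (z <= A)%MS -> (z <= A + W)%MS.
  by move=> zA; apply: submx_trans zA (addsmxSl _ _).
have W_sub (X : 'M_N) : (A *m X <= A)%MS ->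
    (forall a, (a <= r)%N -> (v *m U ^+ a *m X <= A + W)%MS) ->
    ((A + W)%MS *m X <= A + W)%MS.
  move=> AX WX; rewrite addsmxMr addsmx_sub (submx_trans AX) ?addsmxSl //=.
  by apply/row_subP=> a; rewrite row_mul rowK WX // -ltnS.
split=> [||j]; apply: W_sub => // a le_ar.
- case: a le_ar => [|a] lt_ar; first by rewrite mx0 mulmx1 AW.
  rewrite -[_ *m D](subrK (string_coef d a.+1 *: (v *m U ^+ a))).
  rewrite addmx_sub ?scalemx_sub ?string_mx_mem 1?ltnW // AW //.
  apply: string_down => //.
  by apply: leq_trans le_n; rewrite leq_add2l ltnW.
- rewrite -mulmxA -mxSr; have [Ear|ne_ar] := eqVneq a r; first by rewrite Ear AW.
  by rewrite string_mx_mem // ltn_neqAle ne_ar.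
rewrite -(string_grade vP) -mulmxA PP; case: eqP => _.
  by rewrite string_grade ?string_mx_mem.
by rewrite mulmx0 sub0mx.
Qed.

(** The string vectors have distinct degrees d, ..., d + r, so projecting to degree k keeps at most
    the one at s = k - d. *)
Lemma string_mx_component (A : 'M[F]_N) (v z : 'rV_N) d r k :
    graded_stable A -> v *m P d = v -> z *m P k = z ->
    (z <= A + string_mx v r)%MS ->
  (z <= A)%MS \/ exists s, [/\ (s <= r)%N, k = (d + s)%N
     & exists t, (z - t *: (v *m U ^+ s) <= A)%MS].
Proof.
case=> _ _ AP vP zP /sub_addsmxP[[a b] /= Eab].
have {Eab} zE : z = a *m A *m P k + \sum_(i < r.+1) b 0 i *: (v *m U ^+ i *m P k).
  rewrite -zP Eab mulmxDl; congr (_ + _).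
  rewrite [b *m _]mulmx_sum_row mulmx_suml; apply: eq_bigr => i _.
  by rewrite rowK -scalemxAl.
have aA : (a *m A *m P k <= A)%MS by rewrite -mulmxA mulmx_sub.
have [/andP[le_dk le_k]|k_out] := boolP ((d <= k) && (k <= d + r))%N.
  have lt_s : (k - d < r.+1)%N by rewrite ltnS leq_subLR.
  right; exists (k - d)%N; rewrite subnKC //; split=> //.
  exists (b 0 (Ordinal lt_s)); rewrite zE (bigD1 (Ordinal lt_s)) //= big1.
    have := string_grade vP (k - d); rewrite subnKC // => ->.
    by rewrite addr0 addrK.
  move=> i ne_i; rewrite -(string_grade vP) -mulmxA PP.
  case: eqP => [Ei|_]; last by rewrite mulmx0 scaler0.
  by case/negP: ne_i; apply/eqP/val_inj; rewrite /= -Ei addKn.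
left; rewrite zE big1 ?addr0 // => i _.
rewrite -(string_grade vP) -mulmxA PP.
case: eqP => [Ei|_]; last by rewrite mulmx0 scaler0.
by case/negP: k_out; rewrite -Ei leq_addr leq_add2l -ltnS ltn_ord.
Qed.

(* Induction on the codimension of [A]: adjoining to [A] a string that starts at
   a vector of maximal degree among those killed by [D] modulo [A] adds one
   simple subquotient. *)
Lemma powD_exact_mod (A : 'M[F]_N) (x : 'rV_N) k e :
    graded_stable A -> (0 < e < m)%N -> 2 * k = n + e %[mod m] ->
    x *m P k = x -> (x *m D ^+ e <= A)%MS ->
  exists y : 'rV_N, (x - y *m D ^+ (m - e) <= A)%MS.
Proof.
move=> + /andP[_ lt_em] Ek xP.
have [c] := ubnP (N - \rank A); elim: c => // c IH in A * => lt_c stA xDA.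
have [A1|A1] := boolP (1%:M <= A)%MS.
  by exists 0; rewrite mul0mx subr0 (submx_trans (submx1 _) A1).
have [AD AU AP] := stA.
have [d [v [vP vD vA top_d]]] := graded_top stA A1.
have [r [/andP[lt_rm le_n] Er vUr notA coef_neq0]] :=
  string_length stA vP vD vA top_d.
have fit s : k = (d + s)%N -> (s <= r)%N -> (s < e)%N -> (s + (m - e) <= r)%N.
  move=> Ekd le_sr lt_se; apply: string_fit lt_rm Er _ le_sr _; first by rewrite -Ekd.
  by rewrite lt_se.
have stAW := string_mx_stable stA vP vD le_n vUr.
set AW := (A + string_mx v r)%MS in stAW.
have lt_rank : (\rank A < \rank AW)%N.
  apply: rank_ltmx; rewrite /ltmx addsmxSl; apply: contra vA; apply: submx_trans.
  by have := string_mx_mem A v (leq0n r); rewrite mx0 mulmx1.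
have lt_cW : (N - \rank AW < c)%N.
  apply: (@leq_trans (N - \rank A)); last by rewrite -ltnS.
  exact: ltn_sub2l (leq_trans lt_rank (rank_leq_row _)) lt_rank.
have [y yAW] := IH _ lt_cW stAW (submx_trans xDA (addsmxSl _ _)).
(* Keeping only the component of [y] that [D ^+ (m - e)] sends to degree k makes the error [z]
   homogeneous. *)
pose y' := y *m P (k + (m - e)); pose z := x - y' *m D ^+ (m - e).
have zE : z = (x - y *m D ^+ (m - e)) *m P k.
  by rewrite mulmxBl xP /z /y' -!mulmxA grade_powD.
have zP : z *m P k = z by rewrite zE -mulmxA PP eqxx.
have zAW : (z <= AW)%MS.
  by rewrite zE; apply: submx_trans (submxMr _ yAW) _; case: stAW.
(* The correction to [x] is killed by [D ^+ e] because D^m = 0. *)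
have zDA : (z *m D ^+ e <= A)%MS.
  by rewrite /z mulmxBl -mulmxA -mxD subnK ?Dm0 ?mulmx0 ?subr0 // ltnW.
have [zA|[s [le_sr Ek' [t zA]]]] := string_mx_component stA vP zP zAW.
  by exists y'.
(* Modulo [A], [z] is t vU^s. If e <= s, applying D^e gives a nonzero multiple of t vU^(s-e), and
   vU^(s-e) is outside [A], so t = 0. *)
have [le_es|lt_se] := leqP e s.
  exists y'; rewrite -/z.
  have [g g_neq0 gA] := string_powD stA vP vD le_n coef_neq0 le_sr le_es.
  suff t0 : t = 0 by move: zA; rewrite t0 scale0r subr0.
  apply/eqP; apply: contraNT (notA (s - e)%N (leq_trans (leq_subr e s) le_sr)) => t_neq0.
  have tg_neq0 : t * g != 0 by rewrite mulf_neq0.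
  rewrite -[v *m _](scalerK tg_neq0) scalemx_sub //.
  have -> : (t * g) *: (v *m U ^+ (s - e)) =
      z *m D ^+ e - ((z - t *: (v *m U ^+ s)) *m D ^+ e
        + t *: (v *m U ^+ s *m D ^+ e - g *: (v *m U ^+ (s - e)))).
    by rewrite [(z - _) *m _]mulmxBl -scalemxAl scalerBr scalerA addrA subrK subKr.
  by rewrite addmx_sub // eqmx_opp addmx_sub ?scalemx_sub // stable_powD.
(* If s < e, the string extends far enough for vU^s to be, modulo [A] and up to the unit g, the
   image of vU^(s+m-e) under D^(m-e); this corrects [y']. *)
have le_fit := fit s Ek' le_sr lt_se.
have [g g_neq0 gA] :=
  string_powD stA vP vD le_n coef_neq0 le_fit (leq_addl s (m - e)).
exists (y' + (t / g) *: (v *m U ^+ (s + (m - e)))).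
have -> : x - (y' + (t / g) *: (v *m U ^+ (s + (m - e)))) *m D ^+ (m - e) =
    (z - t *: (v *m U ^+ s)) - (t / g) *:
      (v *m U ^+ (s + (m - e)) *m D ^+ (m - e) - g *: (v *m U ^+ (s + (m - e) - (m - e)))).
  rewrite addnK scalerBr scalerA divfK // opprB addrA subrK.
  by rewrite mulmxDl -scalemxAl opprD addrA.
by rewrite addmx_sub // eqmx_opp scalemx_sub.
Qed.

Lemma powD_exact (x : 'rV_N) k e :
    (0 < e < m)%N -> 2 * k = n + e %[mod m] -> x *m P k = x -> x *m D ^+ e = 0 ->
  exists2 y : 'rV_N, y *m P (k + (m - e)) = y & x = y *m D ^+ (m - e).
Proof.
move=> e_bd Ek xP xD0.
have st0 : graded_stable 0 by split=> *; rewrite mul0mx sub0mx.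
have [|y] := powD_exact_mod st0 e_bd Ek xP; first by rewrite xD0 sub0mx.
rewrite submx0 subr_eq0 => /eqP Exy; exists (y *m P (k + (m - e))).
  by rewrite -mulmxA PP eqxx.
by rewrite -mulmxA grade_powD mulmxA -Exy.
Qed.

End GradedExactness.

(** * Counting subspaces *)

Section Counting.
Variables (K : finFieldType) (n : nat).
Local Notation subspace := {vspace 'rV[K]_n}.
Local Notation q := #|K|.
Implicit Types X Y Z : subspace.

Lemma dim_rV_le X : (\dim X <= n)%N.
Proof.
by have := dimvS (subvf X); rewrite dimvf /dim /= mul1n.
Qed.

Lemma dim_addv_line Z (v : 'rV[K]_n) : v \notin Z ->
  \dim (Z + <[v]>)%VS = (\dim Z).+1.
Proof.
move=> vZ; apply/eqP; rewrite eqn_leq; apply/andP; split.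
  apply: leq_trans (dimv_add_leqif _ _) _; rewrite dim_vline.
  by apply: leq_trans (leq_add (leqnn _) (leq_b1 _)) _; rewrite addn1.
rewrite (ltn_leqif (dimv_leqif_sup (addvSl Z <[v]>))).
by apply: contra vZ => /subvP; apply; rewrite memvE addvSr.
Qed.

(** Each vector of X outside Z spans with Z exactly one such Y, and each Y arises from q^(dim Z + 1)
    - q^(dim Z) vectors. Dividing the q^(dim X) - q^(dim Z) vectors among them gives the quantum
    integer. *)
Lemma card_upper_covers Z X : (Z <= X)%VS ->
  #|[set Y : subspace | [&& Z <= Y, Y <= X & \dim Y == (\dim Z).+1]%VS]|
    = qint q (\dim X - \dim Z).
Proof.
move=> ZX; set C := [set Y | _].
have q_gt1 : (1 < q)%N by apply: finNzRing_gt1.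
have card_diff Y : (Z <= Y)%VS ->
    #|[set v in Y | v \notin Z]| = (q ^ \dim Y - q ^ \dim Z)%N.
  move=> ZY; rewrite -!card_vspace.
  have -> : [set v in Y | v \notin Z] = [set v in Y] :\: [set v in Z].
    by apply/setP=> v; rewrite !inE andbC.
  rewrite cardsD (setIidPr _) ?cardsE //.
  by apply/subsetP=> v; rewrite !inE; apply: subvP.
have : (#|C| * (q ^ (\dim Z).+1 - q ^ \dim Z) = q ^ \dim X - q ^ \dim Z)%N.
  rewrite -card_diff // -[RHS]sum1_card.
  rewrite (partition_big (fun v => (Z + <[v]>)%VS) (mem C)) /=; last first.
    move=> v; rewrite !inE => /andP[vX vZ].
    by rewrite addvSl dim_addv_line // eqxx andbT subv_add ZX -memvE.
  rewrite -sum_nat_const; apply: eq_bigr => Y; rewrite inE => /and3P[ZY YX /eqP dY].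
  rewrite -dY -card_diff // -sum1_card; apply: eq_bigl => v; rewrite !inE.
  apply/andP/andP=> [[vY vZ]|[/andP[vX vZ] /eqP<-]].
    rewrite vZ (subvP YX) //; split=> //.
    have sub : (Z + <[v]> <= Y)%VS by rewrite subv_add ZY -memvE.
    by rewrite -(dimv_leqif_eq sub).2 dim_addv_line // dY.
  by split=> //; rewrite memvE addvSr.
have -> : (q ^ (\dim Z).+1 - q ^ \dim Z = q ^ \dim Z * q.-1)%N.
  by rewrite expnSr -subn1 mulnBr muln1.
have -> : (q ^ \dim X - q ^ \dim Z =
    qint q (\dim X - \dim Z) * (q ^ \dim Z * q.-1))%N.
  rewrite -{1}(subnKC (dimvS ZX)) expnD -{2}[(q ^ \dim Z)%N]muln1 -mulnBr subn1.
  by rewrite predn_exp [RHS]mulnC -mulnA.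
by move/eqP; rewrite eqn_pmul2r => [/eqP//|]; rewrite muln_gt0 expn_gt0; lia.
Qed.

(** The q-factorial of a, with q = b. *)
Definition qfact (b a : nat) : nat := (\prod_(t < a) qint b t.+1)%N.

(** An entry of D^a counts saturated chains from Y up to X. The member C next above Y can be chosen
    in [dim X - dim Y] ways, which adds one factor to the q-factorial. *)
Lemma incidence_mxX_E (F : fieldType) a X Y :
  (incidence_mx F K n ^+ a) (enum_rank X) (enum_rank Y) =
    ((Y <= X)%VS && (\dim X == \dim Y + a)%N)%:R * (qfact q a)%:R.
Proof.
elim: a Y => [|a IH] Y.
  rewrite expr0 /qfact big_ord0 mulr1 addn0 mxE (inj_eq enum_rank_inj).
  congr ((nat_of_bool _)%:R); apply/eqP/andP=> [->|[YX /eqP dXY]]; first by rewrite subvv.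
  by apply/esym/eqP; rewrite -(dimv_leqif_eq YX).2 dXY.
rewrite exprSr mxE (reindex _ (onW_bij _ (@enum_rank_bij subspace))) /=.
rewrite (eq_bigr (fun C : subspace =>
   ([&& Y <= C, C <= X & \dim C == (\dim Y).+1]%VS
      && (\dim X == \dim Y + a.+1)%N)%:R * (qfact q a)%:R)); last first.
  move=> C _; rewrite IH mxE !enum_rankK mulrAC -[X in X * _]natrM mulnb.
  congr ((nat_of_bool _)%:R * _).
  case: (Y <= C)%VS; rewrite ?andbF //=; case: (C <= X)%VS; rewrite //= andbC.
  by case: eqP => //= ->; rewrite addSnnS.
rewrite -mulr_suml /qfact big_ord_recr /= natrM mulrA [in RHS]mulrAC; congr (_ * _).
have [dX|_] := eqVneq (\dim X) (\dim Y + a.+1)%N; last first.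
  by rewrite !andbF mul0r big1 // => C _; rewrite andbF.
rewrite andbT; under eq_bigr do rewrite andbT.
rewrite -natr_sum; have [YX|YX] := boolP (Y <= X)%VS.
  have := card_upper_covers YX; rewrite dX addKn mul1r => <-.
  rewrite -sum1_card -big_mkcond; congr (_%:R).
  by apply: eq_bigl => C; rewrite inE.
rewrite mul0r big1 // => C _; case: (boolP (Y <= C)%VS) => //= YC.
by case: (boolP (C <= X)%VS) => //= CX; rewrite (subv_trans YC CX) in YX.
Qed.

(* The complete flags below [X], counted by powers of the incidence map over the
   rationals, number [qfact q (\dim X)]; split them by their hyperplane. *)
Lemma card_lower_covers X :
  #|[set C : subspace | (C <= X)%VS && (\dim X == (\dim C).+1)]|
    = qint q (\dim X).
Proof.
case dX: (\dim X) => [|a].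
  rewrite /qint big_ord0; apply: eq_card0 => C; rewrite inE; exact: andbF.
have := @incidence_mxX_E rat a.+1 X 0%VS; rewrite sub0v dimv0 add0n dX eqxx mul1r.
rewrite exprS mxE (reindex _ (onW_bij _ (@enum_rank_bij subspace))) /=.
rewrite (eq_bigr (fun C : subspace =>
   ((C <= X)%VS && (\dim X == (\dim C).+1))%:R * (qfact q a)%:R)); last first.
  move=> C _; rewrite incidence_mxX_E mxE !enum_rankK sub0v dimv0 add0n mulrA.
  rewrite -[X in X * _]natrM mulnb; congr ((nat_of_bool _)%:R * _).
  by case: (C <= X)%VS => //=; rewrite dX eqSS eq_sym andbb.
(* Characteristic 0 brings the identity back to natural numbers, where the positive factor
   [qfact q a] cancels. *)
rewrite -mulr_suml -natr_sum -natrM => /eqP; rewrite Num.Theory.eqr_nat.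
rewrite /qfact big_ord_recr /= mulnC eqn_pmul2l; last first.
  apply: prodn_gt0 => t; rewrite /qint big_ord_recl; exact: ltn_addr.
move/eqP <-; rewrite -sum1_card -big_mkcond /=.
by apply: eq_bigl => C; rewrite inE dX.
Qed.

End Counting.

(** * Commutation relations of the incidence map and its transpose *)

Section IncidenceRelations.
Variables (F : fieldType) (K : finFieldType) (n : nat).
Local Notation subspace := {vspace 'rV[K]_n}.
Local Notation N := #|{: {vspace 'rV[K]_n}}|.
Local Notation q := #|K|.
Local Notation D := (incidence_mx F K n).
Local Notation P := (chain_mx F K n).
Implicit Types X Y Z : subspace.

Lemma mul_chain_mx k (M : 'M[F]_N) a b :
  (P k *m M) a b = (\dim (enum_val a) == k)%:R * M a b.
Proof. by rewrite mul_diag_mx !mxE. Qed.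

Lemma mul_mx_chain k (M : 'M[F]_N) a b :
  (M *m P k) a b = M a b * (\dim (enum_val b) == k)%:R.
Proof. by rewrite mul_mx_diag !mxE. Qed.

Lemma chain_mx_mul k l : P k *m P l = if k == l then P k else 0.
Proof.
apply/matrixP=> a b; rewrite mul_chain_mx; case: ifPn => [/eqP<-|ne_kl]; last first.
  rewrite !mxE; case: (\dim _ =P k) => [->|_]; last by rewrite mul0r.
  by rewrite (negPf ne_kl) mul0rn mulr0.
by rewrite !mxE; case: (_ == k); rewrite ?mul1r ?mul0r ?mul0rn.
Qed.

Lemma sum_chain_mx : \sum_(k < n.+1) P k = 1%:M.
Proof.
apply/matrixP=> a b; rewrite summxE mxE.
have lt_dn : (\dim (enum_val a) < n.+1)%N by rewrite ltnS dim_rV_le.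
rewrite (bigD1 (Ordinal lt_dn)) //= big1 ?addr0 => [|k ne_k].
  by rewrite !mxE eqxx.
by rewrite !mxE -[_ == _ :> nat]/(Ordinal lt_dn == k) eq_sym (negPf ne_k) mul0rn.
Qed.

Lemma chain_mx_incidence k : P k.+1 *m D = D *m P k.
Proof.
apply/matrixP=> a b; rewrite mul_chain_mx mul_mx_chain mxE -!natrM !mulnb.
congr ((nat_of_bool _)%:R); case: (_ <= _)%VS; rewrite ?andbF //=.
by case: (_ =P (\dim (enum_val b)).+1) => [->|]; rewrite ?andbF ?andbT ?eqSS.
Qed.

Lemma chain_mx0_incidence : P 0 *m D = 0.
Proof.
apply/matrixP=> a b; rewrite mul_chain_mx !mxE -natrM mulnb.
by case: (\dim (enum_val a)) => [|d]; rewrite ?andbF.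
Qed.

Lemma tr_chain_mx k : (P k)^T = P k.
Proof. exact: tr_diag_mx. Qed.

Lemma chain_mx_tr_incidence k : P k *m D^T = D^T *m P k.+1.
Proof.
by apply: trmx_inj; rewrite !trmx_mul trmxK !tr_chain_mx chain_mx_incidence.
Qed.

Lemma up_down_E X Y : (D^T *m D) (enum_rank X) (enum_rank Y) =
  #|[set Z : subspace | [&& X <= Z, Y <= Z, \dim Z == (\dim X).+1
                            & \dim Z == (\dim Y).+1]%VS]|%:R.
Proof.
rewrite mxE (reindex _ (onW_bij _ (@enum_rank_bij subspace))) /=.
rewrite -[in RHS]sum1_card [in RHS]big_mkcond natr_sum; apply: eq_bigr => Z _.
rewrite inE !mxE !enum_rankK -natrM mulnb.
by case: (X <= Z)%VS; case: (Y <= Z)%VS; case: (_ == _); case: (_ == _).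
Qed.

Lemma down_up_E X Y : (D *m D^T) (enum_rank X) (enum_rank Y) =
  #|[set Z : subspace | [&& Z <= X, Z <= Y, \dim X == (\dim Z).+1
                            & \dim Y == (\dim Z).+1]%VS]|%:R.
Proof.
rewrite mxE (reindex _ (onW_bij _ (@enum_rank_bij subspace))) /=.
rewrite -[in RHS]sum1_card [in RHS]big_mkcond natr_sum; apply: eq_bigr => Z _.
rewrite inE !mxE !enum_rankK -natrM mulnb.
by case: (Z <= X)%VS; case: (Z <= Y)%VS; case: (_ == _); case: (_ == _).
Qed.

(** Both counts are 0 or 1: X + Y is the only possible common cover and the intersection of X and Y
    the only possible common hyperplane. By the dimension formula one qualifies exactly when the
    other does. *)
Lemma card_common_covers X Y : X != Y ->
  #|[set Z : subspace | [&& X <= Z, Y <= Z, \dim Z == (\dim X).+1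
                            & \dim Z == (\dim Y).+1]%VS]| =
  #|[set Z : subspace | [&& Z <= X, Z <= Y, \dim X == (\dim Z).+1
                            & \dim Y == (\dim Z).+1]%VS]|.
Proof.
move=> neXY; have [dXY|ne_d] := eqVneq (\dim X) (\dim Y); last first.
  rewrite !eq_card0 // => Z; rewrite inE; apply/negP.
    by case/and4P=> _ _ /eqP dX /eqP dY; case/eqP: ne_d; rewrite dX dY.
  by case/and4P=> _ _ /eqP dX /eqP dY; case/eqP: ne_d; apply: succn_inj; rewrite -dX -dY.
have dcap : (\dim (X :&: Y) < \dim X)%N.
  rewrite (ltn_leqif (dimv_leqif_sup (capvSl X Y))) subv_cap subvv /=.
  by apply: contra neXY => XY; rewrite -(dimv_leqif_eq XY).2 dXY.
have dsum := dimv_sum_cap X Y.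
(* Both cardinalities are compared with the truth value of this one condition. *)
transitivity (\dim X == (\dim (X :&: Y)%VS).+1 : nat); last first.
  case: eqP => [dX|ne_dX]; last first.
    symmetry; apply: eq_card0 => Z; rewrite inE; apply/negP.
    case/and4P=> ZX ZY /eqP dX _; case: ne_dX.
    have : (Z <= X :&: Y)%VS by rewrite subv_cap ZX.
    by move/dimvS; lia.
  symmetry; apply/eqP/cards1P; exists (X :&: Y)%VS; apply/setP=> Z; rewrite !inE.
  apply/and4P/eqP=> [[ZX ZY /eqP dZ _]|->]; last first.
    by rewrite capvSl capvSr -dXY dX eqxx.
  have ZXY : (Z <= X :&: Y)%VS by rewrite subv_cap ZX.
  by apply/eqP; rewrite -(dimv_leqif_eq ZXY).2; lia.
case: eqP => [dX|ne_dX]; last first.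
  apply: eq_card0 => Z; rewrite inE; apply/negP.
  case/and4P=> XZ YZ /eqP dZ _; case: ne_dX.
  have : (X + Y <= Z)%VS by rewrite subv_add XZ.
  by move/dimvS; lia.
apply/eqP/cards1P; exists (X + Y)%VS; apply/setP=> Z; rewrite !inE.
apply/and4P/eqP=> [[XZ YZ /eqP dZ _]|->]; last first.
  by rewrite addvSl addvSr -dXY; split=> //; lia.
have XYZ : (X + Y <= Z)%VS by rewrite subv_add XZ.
by apply/esym/eqP; rewrite -(dimv_leqif_eq XYZ).2; lia.
Qed.

(** Off the diagonal the two products agree by [card_common_covers]. On it, a k-dimensional space
    has [n - k] upper and [k] lower covers. *)
Lemma chain_mx_commutator k : (k <= n)%N ->
  P k *m (D^T *m D) =
    P k *m (D *m D^T) + ((qint q (n - k))%:R - (qint q k)%:R) *: P k.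
Proof.
move=> le_kn; apply/matrixP=> a b; rewrite [in RHS]mxE !mul_chain_mx; set s := _ - _.
have -> : (s *: P k) a b = s * ((\dim (enum_val a) == k)%:R *+ (a == b)).
  by rewrite !mxE.
rewrite {}/s -[a]enum_valK -[b]enum_valK; set X := enum_val a; set Y := enum_val b.
rewrite up_down_E down_up_E.
rewrite !enum_rankK (inj_eq enum_rank_inj).
case: (\dim X =P k) => [dX|_]; last by rewrite !mul0r mul0rn mulr0 addr0.
rewrite !mul1r; have [<-|neXY] := eqVneq X Y; last first.
  by rewrite mulr0n mulr0 addr0 card_common_covers.
have -> : #|[set Z : subspace | [&& X <= Z, X <= Z, \dim Z == (\dim X).+1
                            & \dim Z == (\dim X).+1]%VS]| = qint q (n - k).
  have := card_upper_covers (subvf X); rewrite dX dimvf /dim /= mul1n => <-.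
  by apply: eq_card => Z; rewrite !inE subvf; case: (X <= Z)%VS; rewrite //= andbb.
have -> : #|[set Z : subspace | [&& Z <= X, Z <= X, \dim X == (\dim Z).+1
                            & \dim X == (\dim Z).+1]%VS]| = qint q k.
  rewrite -dX -card_lower_covers.
  by apply: eq_card => Z; rewrite !inE; case: (Z <= X)%VS; rewrite //= andbb.
by rewrite mulr1n mulr1 addrC subrK.
Qed.

(** Every entry of D^m carries the q-factorial of m, whose last factor is [m] = 0. *)
Lemma incidence_mxX_eq0 m : is_qchar F q m -> D ^+ m = 0.
Proof.
case=> m_gt1 qm0 _; apply/matrixP=> a b.
rewrite -[a]enum_valK -[b]enum_valK incidence_mxX_E mxE.
case: m m_gt1 qm0 => // m _ qm0.
by rewrite /qfact big_ord_recr natrM qm0 !mulr0.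
Qed.

Lemma incidence_exact m k e (x : 'rV[F]_N) :
    q%:R != 0 :> F -> is_qchar F q m ->
    (0 < e < m)%N -> 2 * k = n + e %[mod m] ->
    x *m P k = x -> x *m D ^+ e = 0 ->
  exists2 y : 'rV[F]_N, y *m P (k + (m - e)) = y & x = y *m D ^+ (m - e).
Proof.
move=> q_neq0 hm; apply: (powD_exact (n := n) (U := D^T) q_neq0 hm).
- exact: chain_mx_mul.
- exact: sum_chain_mx.
- exact: chain_mx_incidence.
- exact: chain_mx0_incidence.
- exact: chain_mx_tr_incidence.
- exact: chain_mx_commutator.
exact: incidence_mxX_eq0.
Qed.

End IncidenceRelations.

(** * The isomorphisms *)

Section IncidenceIsomorphisms.
Variables (F : fieldType) (K : finFieldType) (n m : nat).
Local Notation N := #|{: {vspace 'rV[K]_n}}|.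
Local Notation D := (incidence_mx F K n).
Local Notation P := (chain_mx F K n).
Local Notation Z := (cycle_mx F K n).
Local Notation B := (boundary_mx F K n m).
Local Notation H := (incidence_homology F K n m).
Hypotheses (q_neq0 : #|K|%:R != 0 :> F) (hm : is_qchar F #|K| m).

Let powD b : forall k, P (k + b) *m D ^+ b = D ^+ b *m P k.
Proof. by move=> k; apply: grade_powD => l; apply: chain_mx_incidence. Qed.

Let mxD a b : D ^+ (a + b) = D ^+ a *m D ^+ b. Proof. exact: exprD. Qed.

Lemma chain_powD (y : 'rV[F]_N) k b :
  y *m P (k + b) = y -> y *m D ^+ b *m P k = y *m D ^+ b.
Proof. by move=> yP; rewrite -mulmxA -powD mulmxA yP. Qed.

Lemma cycle_mxP k i (u : 'rV[F]_N) :
  reflect (u *m P k = u /\ u *m D ^+ i = 0) (u <= Z k i)%MS.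
Proof.
rewrite sub_capmx (sameP sub_kermxP eqP).
apply: (iffP andP) => [[/eqP-> /submxP[w ->]]|[<- ->]]; last by rewrite submxMl.
by rewrite -[LHS]mulmxA chain_mx_mul eqxx.
Qed.

Lemma boundary_mxP k i (u : 'rV[F]_N) :
  reflect (exists2 y : 'rV_N, y *m P (k + (m - i)) = y & u = y *m D ^+ (m - i))
          (u <= B k i)%MS.
Proof.
apply: (iffP submxP) => [[w ->]|[y <- ->]]; last by exists y; rewrite mulmxA.
exists (w *m P (k + (m - i))); last by rewrite mulmxA.
by rewrite -mulmxA chain_mx_mul eqxx.
Qed.

Lemma homology_incl_rsim k i j : (0 < i < j)%N -> (j < m)%N ->
  (i + j + n = 2 * k + m)%N -> mx_rsim (H k i) (H k j).
Proof.
move=> /andP[i_gt0 lt_ij] lt_jm Eij.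
apply: (@section_rsim_hom _ _ _ _ _ _ _ _ _ 1%:M) => [g _||||u].
- by rewrite mulmx1 mul1mx.
- rewrite mulmx1; apply/row_subP=> a; move: (row a _) (row_sub a (B k i)) => u.
  case/boundary_mxP=> y yP ->; apply/boundary_mxP; exists (y *m D ^+ (j - i)).
    by apply: chain_powD; rewrite -[RHS]yP; congr (_ *m P _); lia.
  by rewrite -mulmxA -mxD; congr (_ *m D ^+ _); lia.
- rewrite mulmx1; apply: submx_trans (addsmxSr _ _).
  apply/row_subP=> a; move: (row a _) (row_sub a (Z k i)) => u.
  case/cycle_mxP=> uP uD; apply/cycle_mxP; split=> //.
  by rewrite -(subnKC (ltnW lt_ij)) mxD mulmxA uD mul0mx.
- rewrite mulmx1; apply/row_subP=> a; move: (row a _) (row_sub a (Z k j)) => u.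
  case/cycle_mxP=> uP uD.
  (* For surjectivity, [u] is changed by a boundary [z] into a cycle for D^i. Exactness in degree k
     - i with exponent j - i writes uD^i as yD^(m-j+i), so z = yD^(m-j) works; for k < i, uD^i is
     already 0. *)
  have [z zB zD] : exists2 z : 'rV_N, (z <= B k j)%MS & (u - z) *m D ^+ i = 0.
    have [lt_ki|le_ik] := ltnP k i.
      exists 0; rewrite ?sub0mx // subr0 -uP -mulmxA.
      rewrite (powD_low (chain_mx_incidence F K n) (chain_mx0_incidence F K n)) //.
      by rewrite mulmx0.
    have [||||y yP yD] := @incidence_exact F K n m (k - i) (j - i) (u *m D ^+ i) q_neq0 hm.
    - by apply/andP; lia.
    - rewrite -(modnDr (2 * (k - i))); congr (modn _ _); lia.
    - by apply: chain_powD; rewrite subnK.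
    - by rewrite -mulmxA -mxD subnKC // ltnW.
    exists (y *m D ^+ (m - j)).
      apply/boundary_mxP; exists y => //.
      by rewrite -[RHS]yP; congr (_ *m P _); lia.
    rewrite mulmxBl yD -mulmxA -mxD; apply/eqP; rewrite subr_eq0; apply/eqP.
    by congr (_ *m D ^+ _); lia.
  rewrite -[u](subrK z) addrC addmx_sub_adds //; apply/cycle_mxP; split=> //.
  case/boundary_mxP: zB => y yP Ez.
  by rewrite mulmxBl uP Ez chain_powD.
case/cycle_mxP=> uP uD; rewrite mulmx1 => /boundary_mxP[y yP Eu].
(* For injectivity, exactness with exponent m - j + i writes [y] as y'D^(j-i), which makes [u] an
   image of D^(m-i). *)
have [||||y' yP' Ey] := @incidence_exact F K n m (k + (m - j)) (m - j + i) y q_neq0 hm.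
- by apply/andP; lia.
- by congr (modn _ _); lia.
- by [].
- by rewrite mxD mulmxA -Eu.
apply/boundary_mxP; exists y'; first by rewrite -[RHS]yP'; congr (_ *m P _); lia.
by rewrite Eu Ey -mulmxA -mxD; congr (_ *m D ^+ _); lia.
Qed.

Lemma homology_reflect_rsim k i : middle_index m n k i ->
  mx_rsim (H k i) (H k (2 * k + (m - i) - n)).
Proof.
case/and3P=> le_kn /andP[i_gt0 lt_im] /andP[lt1 lt2].
set j := (_ - n)%N; have Ej : (i + j + n = 2 * k + m)%N by rewrite /j; lia.
have lt_j : (0 < j < m)%N by rewrite /j; lia.
(* The relation [Ej] is symmetric in i and j, so the inclusion applies in either order. *)
clearbody j; have [lt_ij|lt_ji|<-] := ltngtP i j; last exact: mx_rsim_refl.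
  by apply: homology_incl_rsim; rewrite ?i_gt0 //; case/andP: lt_j.
apply: mx_rsim_sym; apply: homology_incl_rsim; rewrite ?lt_ji ?andbT //.
  by case/andP: lt_j.
by rewrite [(j + i)%N]addnC.
Qed.

Lemma homology_powD_rsim k i w : (k <= n)%N -> (2 * k = n + w)%N -> (w < i < m)%N ->
  mx_rsim (H k i) (H (n - k) (i - w)).
Proof.
move=> le_kn Ew /andP[lt_wi lt_im].
apply: (@section_rsim_hom _ _ _ _ _ _ _ _ _ (D ^+ w)) => [g _||||u].
- exact: incidence_mxX_comm.
- apply/row_subP=> a; rewrite row_mul; move: (row a _) (row_sub a (B k i)) => u.
  case/boundary_mxP=> y yP ->; apply/boundary_mxP; exists y.
    by rewrite -[RHS]yP; congr (_ *m P _); lia.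
  by rewrite -mulmxA -mxD; congr (_ *m D ^+ _); lia.
- apply: submx_trans (addsmxSr _ _).
  apply/row_subP=> a; rewrite row_mul; move: (row a _) (row_sub a (Z k i)) => u.
  case/cycle_mxP=> uP uD; apply/cycle_mxP; split.
    by apply: chain_powD; rewrite -[RHS]uP; congr (_ *m P _); lia.
  by rewrite -mulmxA -mxD subnKC // ltnW.
- apply: submx_trans (addsmxSr _ _).
  apply/row_subP=> a; move: (row a _) (row_sub a (Z (n - k) (i - w))) => u.
  case/cycle_mxP=> uP uD.
  (* Surjectivity: [u] is killed by D^(i-w), hence by D^(m-w), and exactness in degree n - k puts it
     in the image of D^w. For w = 0 this exponent would be m, out of range, but then D^w is the
     identity. *)
  have [y yP Eu] : exists2 y : 'rV_N, y *m P k = y & u = y *m D ^+ w.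
    have [w0|w_gt0] := posnP w.
      exists u; last by rewrite w0 expr0 mulmx1.
      by rewrite -[RHS]uP; congr (_ *m P _); lia.
    have [||||y yP yD] := @incidence_exact F K n m (n - k) (m - w) u q_neq0 hm.
    - by apply/andP; lia.
    - rewrite -(modnDr (2 * (n - k))); congr (modn _ _); lia.
    - by [].
    - have -> : (m - w = (i - w) + (m - i))%N by lia.
      by rewrite mxD mulmxA uD mul0mx.
    exists y; first by rewrite -[RHS]yP; congr (_ *m P _); lia.
    by rewrite yD; congr (_ *m D ^+ _); lia.
  rewrite Eu submxMr //; apply/cycle_mxP; split=> //.
  by rewrite -(subnKC (ltnW lt_wi)) mxD mulmxA -Eu.
case/cycle_mxP=> uP uD /boundary_mxP[y yP Eu].
have yPk : y *m P (k + (m - i)) = y by rewrite -[RHS]yP; congr (_ *m P _); lia.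
(* Injectivity: [u] minus a boundary is killed by D^w, so by exactness in degree k it lies in the
   image of D^(m-w), itself contained in that of D^(m-i). *)
have Ed : (u - y *m D ^+ (m - i)) *m D ^+ w = 0.
  rewrite mulmxBl Eu -mulmxA -mxD; apply/eqP; rewrite subr_eq0; apply/eqP.
  by congr (_ *m D ^+ _); lia.
apply/boundary_mxP; have [w0|w_gt0] := posnP w.
  exists y => //; apply/eqP; rewrite -subr_eq0.
  by move: Ed; rewrite w0 expr0 mulmx1 => ->.
have [||||y' yP' Ey] :=
    @incidence_exact F K n m k w (u - y *m D ^+ (m - i)) q_neq0 hm.
- by apply/andP; lia.
- by rewrite Ew.
- by rewrite mulmxBl uP chain_powD.
- by [].
have Emw : (m - w = (i - w) + (m - i))%N by lia.
exists (y + y' *m D ^+ (i - w)).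
  rewrite mulmxDl yPk chain_powD // -[RHS]yP'; congr (_ *m P _); lia.
by rewrite mulmxDl -mulmxA -mxD -Emw -Ey addrC subrK.
Qed.

Lemma homology_dual_rsim_ge k i : middle_index m n k i -> (n <= 2 * k)%N ->
  mx_rsim (H k i) (H (n - k) (m - i)).
Proof.
case/and3P=> le_kn /andP[i_gt0 lt_im] /andP[lt1 lt2] le_n.
apply: mx_rsim_trans (homology_powD_rsim (w := 2 * k - n) le_kn _ _) _.
- by lia.
- by lia.
apply: mx_rsim_sym.
(* The index i - w reached by D^w is the reflection in (ii) of the index m - i at n - k. *)
have -> : (i - (2 * k - n) = 2 * (n - k) + (m - (m - i)) - n)%N by lia.
apply: homology_reflect_rsim; apply/and3P; split; lia.
Qed.

(** The involution sending (k, i) to (n - k, m - i) preserves middle indices and exchanges the cases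
    n <= 2k and 2k <= n. *)
Lemma homology_dual_rsim k i : middle_index m n k i ->
  mx_rsim (H k i) (H (n - k) (m - i)).
Proof.
move=> mid; have [le_n|lt_n] := leqP n (2 * k); first exact: homology_dual_rsim_ge.
case/and3P: mid => le_kn /andP[i_gt0 lt_im] /andP[lt1 lt2]; apply: mx_rsim_sym.
have := @homology_dual_rsim_ge (n - k) (m - i).
by rewrite (subKn le_kn) (subKn (ltnW lt_im)); apply; [apply/and3P; split; lia | lia].
Qed.

End IncidenceIsomorphisms.
Local Close Scope ring_scope.

Theorem theorem2 (q : nat) (Fq : finFieldType) (hq : #|Fq| = q)
    (p : nat) (F : fieldType) (hp : p \in [pchar F]%R) (hpq : ~~ (p %| q))
    (m : nat) (hm : is_qchar F q m)
    (n k i : nat) (hki : middle_index m n k i) :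
  let j := 2 * k + (m - i) - n in
     mx_rsim (incidence_homology F Fq n m k i)
             (incidence_homology F Fq n m (n - k) (m - i))
  /\ mx_rsim (incidence_homology F Fq n m k i)
             (incidence_homology F Fq n m k j).
Proof.
subst q => /=; have q_neq0 : (#|Fq|%:R != 0 :> F)%R by rewrite -(dvdn_pcharf hp).
by split; [apply: homology_dual_rsim | apply: homology_reflect_rsim].
Qed.
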